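(* Let $\mathbf{X}$ be a random vector in $\mathbb{R}^d$, $u:\mathbb{R}^d\to\mathbb{R}$ continuously differentiable, $\Phi\in C^1(\mathbb{R}^d,\mathbb{R}^K)$, $R\in\mathbb{R}^{K\times K}$ symmetric positive definite, and $$\mathcal{G}_1=\{g:\mathbf{x}\mapsto G^T\Phi(\mathbf{x})\ :\ G\in\mathbb{R}^K,\ G^TRG=1\}.$$ The minimizers of $\mathcal{L}_1$ over $\mathcal{G}_1$ are the functions of the form $g^*(\mathbf{x})=G^{*T}\Phi(\mathbf{x})$, where $G^*$ is a solution to the generalized eigenvalue problem $$\min_{G\in\mathbb{R}^K,\ G^TRG=1}G^THG,$$ with $$H:=\mathbb{E}\big[\|\nabla u(\mathbf{X})\|_2^2\nabla\Phi(\mathbf{X})^T\nabla\Phi(\mathbf{X})\big]-\mathbb{E}\big[\nabla\Phi(\mathbf{X})^T\nabla u(\mathbf{X})\nabla u(\mathbf{X})^T\nabla\Phi(\mathbf{X})\big]\in\mathbb{R}^{K\times K}.$$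
   Context: $\nabla\Phi(\mathbf{x})=(\partial\Phi_j/\partial x_i(\mathbf{x}))_{1\le i\le d,1\le j\le K}\in\mathbb{R}^{d\times K}$. For a vector $\mathbf{v}\in\mathbb{R}^d$, $\Pi^{\perp}_{\mathbf{v}}$ is the orthogonal projector of $\mathbb{R}^d$ onto $\mathrm{span}\{\mathbf{v}\}^\perp$, and for $g\in C^1(\mathbb{R}^d,\mathbb{R})$, $$\mathcal{L}_1(g):=\mathbb{E}\big[\|\nabla u(\mathbf{X})\|_2^2\,\|\Pi^{\perp}_{\nabla u(\mathbf{X})}\nabla g(\mathbf{X})\|_2^2\big].$$ It is assumed that $\mathbb{E}[\|\nabla u(\mathbf{X})\|_2^2\|\nabla\Phi(\mathbf{X})\|_F^2]<\infty$, so that $H$ is well defined. *)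

(* Defs.v *)
From HB Require Import structures.
From mathcomp Require Import all_boot all_order all_algebra.
From mathcomp Require Import all_classical all_reals all_analysis.

Set Implicit Arguments.
Unset Strict Implicit.
Unset Printing Implicit Defensive.

Import Order.TTheory GRing.Theory Num.Theory.
Import numFieldNormedType.Exports.

Local Open Scope classical_set_scope.
Local Open Scope ring_scope.

(* R^d is 'cV[R]_d. The norm the library puts on 'cV[R]_d is the sup norm: it is
   used only for topology and differentiation (all norms are equivalent there),
   never for the quantities below, which use the Frobenius norm. *)

(* On a column vector this is the Euclidean norm. *)
Definition fnorm (R : realType) (m n : nat) (A : 'M[R]_(m, n)) : R :=
  Num.sqrt (\sum_(i < m) \sum_(j < n) A i j ^+ 2).

(* R^d with its Borel sigma-algebra. *)
Definition borelV (R : realType) (d : nat) :=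
  g_sigma_algebraType (@open 'cV[R]_d).

Definition partial (R : realType) (d : nat) (W : normedModType R)
    (f : 'cV[R]_d -> W) (i : 'I_d) (x : 'cV[R]_d) : W :=
  'D_(delta_mx i ord0) f x.

Definition C1 (R : realType) (d : nat) (W : normedModType R)
    (f : 'cV[R]_d -> W) : Prop :=
  (forall x, differentiable f x) /\ (forall i, continuous (partial f i)).

Definition grad (R : realType) (d : nat) (g : 'cV[R]_d -> R)
    (x : 'cV[R]_d) : 'cV[R]_d :=
  \col_(i < d) partial g i x.

(* Transpose of the usual Jacobian: column j is the gradient of Phi_j. *)
Definition gradm (R : realType) (d K : nat) (Phi : 'cV[R]_d -> 'cV[R]_K)
    (x : 'cV[R]_d) : 'M[R]_(d, K) :=
  \matrix_(i < d, j < K) partial (fun y => Phi y j ord0) i x.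

(* Orthogonal projector onto span{v}^perp, i.e. the projector onto this subspace
   along span{v}. proj_mx acts on row vectors from the right, hence the
   transposes; the row space of kermx v is {r | r *m v = 0} = span{v}^perp.
   For v = 0 it is the identity. *)
Definition orthproj (R : realType) (d : nat) (v : 'cV[R]_d) : 'M[R]_d :=
  (proj_mx (kermx v) <<v^T>>%MS)^T.

Definition posdef (R : realType) (n : nat) (A : 'M[R]_n) : Prop :=
  A^T = A /\ forall x : 'cV[R]_n, x != 0 -> 0 < (x^T *m A *m x) ord0 ord0.

Definition minimizers (disp : Order.disp_t) (U : porderType disp) (S : Type)
    (f : S -> U) (A : set S) : set S :=
  [set a | A a /\ forall b, A b -> (f a <= f b)%O].

Section Setting.
Context (disp : measure_display) (T : measurableType disp) (R : realType).
Variables (P : probability T R) (d K : nat).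

(* Only meaningful when every entry of M is integrable. *)
Definition expectation_mx (m n : nat) (M : T -> 'M[R]_(m, n)) : 'M[R]_(m, n) :=
  \matrix_(i < m, j < n) fine 'E_P[fun w => M w i j].

Definition L1loss (X : T -> 'cV[R]_d) (u g : 'cV[R]_d -> R) : \bar R :=
  'E_P[fun w => fnorm (grad u (X w)) ^+ 2
       * fnorm (orthproj (grad u (X w)) *m grad g (X w)) ^+ 2].

Definition Hmx (X : T -> 'cV[R]_d) (u : 'cV[R]_d -> R)
    (Phi : 'cV[R]_d -> 'cV[R]_K) : 'M[R]_K :=
  expectation_mx (fun w => fnorm (grad u (X w)) ^+ 2
      *: ((gradm Phi (X w))^T *m gradm Phi (X w)))
  - expectation_mx (fun w => (gradm Phi (X w))^T *m grad u (X w)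
      *m (grad u (X w))^T *m gradm Phi (X w)).

Definition lincomb (Phi : 'cV[R]_d -> 'cV[R]_K) (G : 'cV[R]_K) : 'cV[R]_d -> R :=
  fun x => (G^T *m Phi x) ord0 ord0.

Definition quadform (A : 'M[R]_K) (G : 'cV[R]_K) : R :=
  (G^T *m A *m G) ord0 ord0.

Definition unit_sphere (A : 'M[R]_K) : set 'cV[R]_K :=
  [set G | quadform A G = 1].

Definition G1class (A : 'M[R]_K) (Phi : 'cV[R]_d -> 'cV[R]_K) :
    set ('cV[R]_d -> R) :=
  [set g | exists2 G, unit_sphere A G & g = lincomb Phi G].

End Setting.

(* Main.v *)
Require Import Defs.
From mathcomp Require Import all_boot all_order all_algebra.
From mathcomp Require Import all_classical all_reals all_analysis.
From mathcomp Require Import measurable_realfun ring.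

Import Order.TTheory GRing.Theory Num.Theory.
Import numFieldNormedType.Exports.

Local Open Scope classical_set_scope.
Local Open Scope ring_scope.

(** The loss of a linear combination [lincomb Phi G] is exactly the quadratic
    form [quadform H G] ([L1loss_lincomb]), so minimizing the loss over the
    class is minimizing this quadratic form over the sphere
    ([minimizers_image]).

    Fix a point, let [v] be the gradient of [u] and [A] the transposed Jacobian
    of [Phi] there. The gradient of [lincomb Phi G] is [A *m G]
    ([grad_lincomb]), and Pythagoras ([sqr_fnorm_orthproj]) gives
    |v|^2 |proj (A G)|^2 = |v|^2 |A G|^2 - (v^T A G)^2, which is the value at [G]
    of the quadratic form of |v|^2 A^T A - A^T v v^T A
    ([quadform_orthproj]). Both matrices have entries bounded by
    |v|^2 |A|_F^2 (Cauchy-Schwarz: [gram_entry_le], [rank1_entry_le]), which is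
    integrable by hypothesis, and they are measurable because [u] and [Phi] are
    C^1. The expectation therefore passes through the quadratic form
    ([expectation_quadform]) and through the difference ([expectation_mxB]). *)

(** * Frobenius norm and orthogonal projector *)

Lemma sqr_fnormE {R : realType} {m n : nat} (A : 'M[R]_(m, n)) :
  fnorm A ^+ 2 = \sum_(i < m) \sum_(j < n) A i j ^+ 2.
Proof.
rewrite /fnorm sqr_sqrtr// sumr_ge0// => i _.
by rewrite sumr_ge0// => j _; rewrite sqr_ge0.
Qed.

Lemma sqr_fnorm_cV {R : realType} {d : nat} (v : 'cV[R]_d) :
  fnorm v ^+ 2 = (v^T *m v) ord0 ord0.
Proof.
rewrite sqr_fnormE mxE; apply: eq_bigr => i _.
by rewrite big_ord1 mxE expr2.
Qed.

Lemma sqr_fnorm_eq0 {R : realType} {d : nat} (v : 'cV[R]_d) :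
  (fnorm v ^+ 2 == 0) = (v == 0).
Proof.
apply/idP/idP => [|/eqP->]; last by rewrite sqr_fnorm_cV mulmx0 mxE.
rewrite sqr_fnormE psumr_eq0 => [/allP v0|i _]; last first.
  by rewrite sumr_ge0// => j _; rewrite sqr_ge0.
apply/eqP/colP => i; rewrite mxE; apply/eqP.
have := v0 i (mem_index_enum i).
by rewrite /= big_ord1 sqrf_eq0.
Qed.

Lemma sqr_fnorm_col_le {R : realType} {d K : nat} (A : 'M[R]_(d, K)) (j : 'I_K) :
  fnorm (col j A) ^+ 2 <= fnorm A ^+ 2.
Proof.
rewrite !sqr_fnormE; apply: ler_sum => i _.
rewrite big_ord1 mxE (bigD1 j)//= lerDl sumr_ge0// => k _.
exact: sqr_ge0.
Qed.

Lemma mx11_tr_dot {R : realType} {d : nat} (v w : 'cV[R]_d) :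
  (w^T *m v) ord0 ord0 = (v^T *m w) ord0 ord0.
Proof. by rewrite !mxE; apply: eq_bigr => i _; rewrite !mxE mulrC. Qed.

(** For nonzero [v] the abstract projector is the usual rank-one correction of
    the identity. *)
Lemma orthprojE {R : realType} {d : nat} (v w : 'cV[R]_d) : v != 0 ->
  orthproj v *m w
  = w - ((v^T *m w) ord0 ord0 / fnorm v ^+ 2) *: v.
Proof.
move=> v0; rewrite /orthproj; set s := fnorm v ^+ 2.
have s0 : s != 0 by rewrite sqr_fnorm_eq0.
set t := (v^T *m w) ord0 ord0.
(* The two subspaces are in direct sum: if [c *: v^T] kills [v] then
   [c * |v|^2 = 0]. *)
have dx : (kermx v :&: <<v^T>> = 0)%MS.
  apply/eqP; rewrite -submx0; apply/rV_subP => r; rewrite sub_capmx.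
  move=> /andP[/sub_kermxP rv]; rewrite genmxE => /sub_rVP[c rE].
  move: rv; rewrite rE -scalemxAl => /matrixP/(_ ord0 ord0).
  rewrite mxE -sqr_fnorm_cV -/s [RHS]mxE => /eqP.
  by rewrite mulf_eq0 (negbTE s0) orbF => /eqP->; rewrite scale0r sub0mx.
apply: trmx_inj; rewrite trmx_mul trmxK linearB linearZ /=.
(* Split [w^T] along the direct sum; the projector keeps the first summand and
   kills the second. *)
have -> : w^T = (w^T - (t / s) *: v^T) + (t / s) *: v^T by rewrite subrK.
rewrite mulmxDl (proj_mx_id dx) ?(proj_mx_0 dx) ?addr0 ?addrK //.
- by rewrite genmxE scalemx_sub.
- apply/sub_kermxP/matrixP => i j; rewrite !ord1.
  rewrite mulmxBl -scalemxAl [LHS]mxE [X in _ + X]mxE [X in - X]mxE.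
  by rewrite -sqr_fnorm_cV -/s divfK// mx11_tr_dot subrr mxE.
Qed.

(** Pythagoras, scaled by the squared norm of [v] so that it also holds at
    [v = 0]. *)
Lemma sqr_fnorm_orthproj {R : realType} {d : nat} (v w : 'cV[R]_d) :
  fnorm v ^+ 2 * fnorm (orthproj v *m w) ^+ 2
  = fnorm v ^+ 2 * fnorm w ^+ 2 - (v^T *m w) ord0 ord0 ^+ 2.
Proof.
have [->|v0] := eqVneq v 0.
  rewrite (_ : fnorm 0 ^+ 2 = 0); last by apply/eqP; rewrite sqr_fnorm_eq0.
  by rewrite !mul0r trmx0 mul0mx mxE expr0n subrr.
rewrite orthprojE//; set s := fnorm v ^+ 2; set t := (v^T *m w) ord0 ord0.
have s0 : s != 0 by rewrite sqr_fnorm_eq0.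
have -> : fnorm (w - (t / s) *: v) ^+ 2 =
    fnorm w ^+ 2 - 2 * (t / s) * t + (t / s) ^+ 2 * s.
  rewrite /s !sqr_fnormE /t mxE mulr_sumr [in RHS]mulr_sumr -sumrB -big_split/=.
  by apply: eq_bigr => i _; rewrite !big_ord1 !mxE -/s; ring.
by field.
Qed.

(** The defect in Cauchy-Schwarz is the left-hand side of the scaled Pythagoras
    identity, hence nonnegative. *)
Lemma cauchy_schwarz_cV {R : realType} {d : nat} (v w : 'cV[R]_d) :
  (v^T *m w) ord0 ord0 ^+ 2 <= fnorm v ^+ 2 * fnorm w ^+ 2.
Proof. by rewrite -subr_ge0 -sqr_fnorm_orthproj mulr_ge0// sqr_ge0. Qed.

(** * The pointwise quadratic form *)

Lemma quadformE {R : realType} {K : nat} (A : 'M[R]_K) (G : 'cV[R]_K) :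
  quadform A G = \sum_(i < K) \sum_(j < K) (G i ord0 * G j ord0) * A i j.
Proof.
rewrite /quadform -mulmxA mxE; apply: eq_bigr => i _.
rewrite !mxE mulr_sumr; apply: eq_bigr => j _; ring.
Qed.

Lemma quadform_orthproj {R : realType} {d K : nat} (v : 'cV[R]_d)
    (A : 'M[R]_(d, K)) (G : 'cV[R]_K) :
  fnorm v ^+ 2 * fnorm (orthproj v *m (A *m G)) ^+ 2
  = quadform (fnorm v ^+ 2 *: (A^T *m A) - A^T *m v *m v^T *m A) G.
Proof.
rewrite sqr_fnorm_orthproj [in fnorm (A *m G) ^+ 2]sqr_fnorm_cV /quadform.
set s := fnorm v ^+ 2.
have -> : G^T *m (s *: (A^T *m A) - A^T *m v *m v^T *m A) *m G
    = s *: ((A *m G)^T *m (A *m G))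
      - ((A *m G)^T *m v) *m (v^T *m (A *m G)).
  by rewrite mulmxBr mulmxBl -scalemxAr -scalemxAl trmx_mul !mulmxA.
have subE (B C : 'M[R]_1) : (B - C) ord0 ord0 = B ord0 ord0 - C ord0 ord0.
  by rewrite !mxE.
rewrite subE [in RHS]mxE; congr (_ - _).
by rewrite [RHS]mxE big_ord1 mx11_tr_dot expr2.
Qed.

(** The entries of [A^T *m A] are dot products of columns of [A], so
    Cauchy-Schwarz applies. *)
Lemma gram_entry_le {R : realType} {d K : nat} (A : 'M[R]_(d, K)) (i j : 'I_K) :
  `|(A^T *m A) i j| <= fnorm A ^+ 2.
Proof.
have colE k l : (A^T *m A) k l = ((col k A)^T *m col l A) ord0 ord0.
  by rewrite !mxE; apply: eq_bigr => m _; rewrite !mxE.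
have n0 : 0 <= fnorm A ^+ 2 by rewrite sqr_ge0.
rewrite -(@ler_pXn2r _ 2)// ?nnegrE// -normrX ger0_norm ?sqr_ge0// colE.
apply: (le_trans (cauchy_schwarz_cV _ _)); rewrite [leRHS]expr2.
by rewrite ler_pM ?sqr_ge0 ?sqr_fnorm_col_le.
Qed.

(** An entry of [A^T v v^T A] is the product of the dot products of [v] with two
    columns of [A]. *)
Lemma rank1_entry_le {R : realType} {d K : nat} (v : 'cV[R]_d)
    (A : 'M[R]_(d, K)) (i j : 'I_K) :
  `|(A^T *m v *m v^T *m A) i j| <= fnorm v ^+ 2 * fnorm A ^+ 2.
Proof.
have -> : (A^T *m v *m v^T *m A) i j
    = (v^T *m col i A) ord0 ord0 * (v^T *m col j A) ord0 ord0.
  rewrite -mulmxA mxE big_ord1; congr (_ * _).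
    by rewrite !mxE; apply: eq_bigr => m _; rewrite !mxE mulrC.
  by rewrite !mxE; apply: eq_bigr => m _; rewrite !mxE.
have le k : `|(v^T *m col k A) ord0 ord0| <= fnorm v * fnorm A.
  have n0 : 0 <= fnorm v * fnorm A by rewrite mulr_ge0// sqrtr_ge0.
  rewrite -(@ler_pXn2r _ 2)// ?nnegrE// -normrX ger0_norm ?sqr_ge0//.
  apply: (le_trans (cauchy_schwarz_cV _ _)).
  by rewrite exprMn ler_wpM2l ?sqr_ge0 ?sqr_fnorm_col_le.
by rewrite normrM -exprMn expr2 ler_pM.
Qed.

(** * Partial derivatives *)

Lemma C1_derivable {R : realType} {d : nat} {W : normedModType R}
    (f : 'cV[R]_d -> W) (x v : 'cV[R]_d) : C1 f -> derivable f x v.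
Proof. by move=> [df _]; exact: diff_derivable. Qed.

Lemma partial_coord {R : realType} {d K : nat} (Phi : 'cV[R]_d -> 'cV[R]_K)
    (i : 'I_d) (j : 'I_K) : C1 Phi ->
  partial (fun y => Phi y j ord0) i = (fun x => partial Phi i x j ord0).
Proof.
move=> hPhi; apply/funext => x; rewrite /partial derive_mx ?mxE//.
exact: C1_derivable.
Qed.

Lemma continuous_gradm {R : realType} {d K : nat} (Phi : 'cV[R]_d -> 'cV[R]_K)
    (i : 'I_d) (j : 'I_K) : C1 Phi -> continuous (fun x => gradm Phi x i j).
Proof.
move=> hPhi.
rewrite (_ : (fun _ => _) = (fun x => partial Phi i x j ord0)); last first.
  by apply/funext => x; rewrite mxE partial_coord.
move=> x; apply: (@continuous_comp _ _ _ (partial Phi i) (fun M => M j ord0)).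
  exact: hPhi.2.
exact: coord_continuous.
Qed.

Lemma grad_lincomb {R : realType} {d K : nat} (Phi : 'cV[R]_d -> 'cV[R]_K)
    (G : 'cV[R]_K) (x : 'cV[R]_d) : C1 Phi ->
  grad (lincomb Phi G) x = gradm Phi x *m G.
Proof.
move=> hPhi; apply/colP => i; rewrite !mxE /partial.
have dPhi j : derivable (fun y => Phi y j ord0) x (delta_mx i ord0).
  by apply: (derivable_mxP _ _ _).1; exact: C1_derivable.
have -> : lincomb Phi G
    = \sum_(j < K) (G j ord0 \*: (fun y => Phi y j ord0)).
  apply/funext => y; rewrite fct_sumE /lincomb mxE.
  by apply: eq_bigr => j _; rewrite mxE.
rewrite derive_sum => [|j]; last exact: derivableZ.
by apply: eq_bigr => j _; rewrite deriveZ// mxE mulrC.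
Qed.

(** * Measurability and expectation *)

Lemma measurable_continuous_borelV {disp : measure_display}
    {T : measurableType disp} {R : realType} {d : nat} {P : probability T R}
    (X : {RV P >-> borelV R d}) (f : 'cV[R]_d -> R) :
  continuous f -> measurable_fun setT (fun w => f (X w)).
Proof.
move=> /continuousP cf.
have mf : measurable_fun setT (f : borelV R d -> R).
  apply: (measurability _ (RGenOpens.measurableE R)).
  move=> _ [_ [a [b ->] <-]]; rewrite setTI.
  by apply: sub_sigma_algebra; exact/cf/interval_open.
exact: (measurableT_comp mf).
Qed.

Lemma measurable_mulmx {disp : measure_display} {T : measurableType disp}
    {R : realType} {m n p : nat} (A : T -> 'M[R]_(m, n)) (B : T -> 'M[R]_(n, p)) :
  (forall i j, measurable_fun setT (fun w => A w i j)) ->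
  (forall i j, measurable_fun setT (fun w => B w i j)) ->
  forall i j, measurable_fun setT (fun w => (A w *m B w) i j).
Proof.
move=> mA mB i j; under eq_fun do rewrite mxE.
by apply: measurable_sum => k; exact: measurable_funM.
Qed.

Lemma measurable_sqr_fnorm {disp : measure_display} {T : measurableType disp}
    {R : realType} {m n : nat} (A : T -> 'M[R]_(m, n)) :
  (forall i j, measurable_fun setT (fun w => A w i j)) ->
  measurable_fun setT (fun w => fnorm (A w) ^+ 2).
Proof.
move=> mA; under eq_fun do rewrite sqr_fnormE.
apply: measurable_sum => i; apply: measurable_sum => j.
exact: measurable_funX.
Qed.

Section Expectation.
Context {disp : measure_display} {T : measurableType disp} {R : realType}.
Variable P : probability T R.

(** A random matrix all of whose entries are integrable. This is what makes
    [expectation_mx] meaningful, since it takes the finite part of the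
    expectation of each entry. *)
Definition integrable_mx {m n : nat} (M : T -> 'M[R]_(m, n)) : Prop :=
  forall i j, P.-integrable setT (fun w => (M w i j)%:E).

Lemma integrable_mxB {m n : nat} (M N : T -> 'M[R]_(m, n)) :
  integrable_mx M -> integrable_mx N -> integrable_mx (fun w => M w - N w).
Proof.
move=> iM iN i j; under eq_fun do rewrite !mxE EFinB.
exact: integrableB.
Qed.

Lemma expectation_mxB {m n : nat} (M N : T -> 'M[R]_(m, n)) :
  integrable_mx M -> integrable_mx N ->
  expectation_mx P (fun w => M w - N w)
  = expectation_mx P M - expectation_mx P N.
Proof.
move=> iM iN; apply/matrixP => i j; rewrite !mxE !expectation.unlock.
under eq_integral do rewrite !mxE EFinB.
rewrite integralB//= fineB//; exact: integrable_fin_num.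
Qed.

Lemma expectation_quadform {K : nat} (M : T -> 'M[R]_K) (G : 'cV[R]_K) :
  integrable_mx M ->
  ('E_P[fun w => quadform (M w) G] = (quadform (expectation_mx P M) G)%:E)%E.
Proof.
move=> iM; rewrite expectation.unlock.
under eq_integral.
  move=> w _; rewrite quadformE -sumEFin.
  under eq_bigr do rewrite -sumEFin.
  under eq_bigr do under eq_bigr do rewrite EFinM.
  over.
have iZ i j : P.-integrable setT
    (fun w => ((G i ord0 * G j ord0)%:E * (M w i j)%:E)%E).
  exact: integrableZl.
rewrite integral_sum//= => [|i]; last exact: integrable_sum.
rewrite quadformE -sumEFin; apply: eq_bigr => i _.
rewrite integral_sum//= -sumEFin; apply: eq_bigr => j _.
rewrite integralZl// mxE expectation.unlock [in RHS]EFinM fineK//.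
exact: integrable_fin_num.
Qed.

Lemma integrable_mx_dominated {m n : nat} (M : T -> 'M[R]_(m, n)) (h : T -> R) :
  (forall i j, measurable_fun setT (fun w => M w i j)) ->
  (forall w i j, `|M w i j| <= h w) ->
  P.-integrable setT (EFin \o h) -> integrable_mx M.
Proof.
move=> mM Mh ih i j; apply: (le_integrable _ _ _ ih) => //.
  exact/measurable_EFinP.
move=> w _ /=; rewrite lee_fin.
exact: le_trans (ler_norm _).
Qed.

End Expectation.

(** * The loss on linear combinations *)

Section Loss.
Context {disp : measure_display} {T : measurableType disp} {R : realType}.
Context {P : probability T R} {d K : nat}.
Variable (X : {RV P >-> borelV R d}).
Variables (u : 'cV[R]_d -> R) (Phi : 'cV[R]_d -> 'cV[R]_K).
Hypotheses (hu : C1 u) (hPhi : C1 Phi).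
Hypothesis hint : ('E_P[(fun w => fnorm (grad u (X w)) ^+ 2
                            * fnorm (gradm Phi (X w)) ^+ 2)%R] < +oo)%E.

Let measurable_gradm (i : 'I_d) (j : 'I_K) :
  measurable_fun setT (fun w => gradm Phi (X w) i j).
Proof.
apply: (measurable_continuous_borelV X (fun x => gradm Phi x i j)).
exact: continuous_gradm.
Qed.

Let measurable_gradm_tr (i : 'I_K) (j : 'I_d) :
  measurable_fun setT (fun w => (gradm Phi (X w))^T i j).
Proof. by under eq_fun do rewrite mxE; exact: measurable_gradm. Qed.

Let measurable_grad (i : 'I_d) (j : 'I_1) :
  measurable_fun setT (fun w => grad u (X w) i j).
Proof.
under eq_fun do rewrite mxE.
exact/(measurable_continuous_borelV X (partial u i))/hu.2.
Qed.

Let measurable_grad_tr (i : 'I_1) (j : 'I_d) :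
  measurable_fun setT (fun w => (grad u (X w))^T i j).
Proof. by under eq_fun do rewrite mxE; exact: measurable_grad. Qed.

Let integrable_bound : P.-integrable setT (EFin \o
  (fun w => fnorm (grad u (X w)) ^+ 2 * fnorm (gradm Phi (X w)) ^+ 2)).
Proof.
apply/integrableP; split.
  by apply/measurable_EFinP/measurable_funM; exact: measurable_sqr_fnorm.
move: hint; rewrite expectation.unlock; congr (_ < _)%E.
by apply: eq_integral => w _ /=; rewrite ger0_norm// mulr_ge0// sqr_ge0.
Qed.

Lemma integrable_gram_term : integrable_mx P (fun w =>
  fnorm (grad u (X w)) ^+ 2 *: ((gradm Phi (X w))^T *m gradm Phi (X w))).
Proof.
apply: integrable_mx_dominated integrable_bound => [i j|w i j].
  under eq_fun do rewrite mxE.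
  apply: measurable_funM; first exact: measurable_sqr_fnorm.
  exact: measurable_mulmx.
rewrite mxE normrM ger0_norm ?sqr_ge0// ler_wpM2l ?sqr_ge0//.
exact: gram_entry_le.
Qed.

Lemma integrable_rank1_term : integrable_mx P (fun w =>
  (gradm Phi (X w))^T *m grad u (X w) *m (grad u (X w))^T *m gradm Phi (X w)).
Proof.
apply: integrable_mx_dominated integrable_bound => [|w i j]; last first.
  exact: rank1_entry_le.
by do 3?apply: measurable_mulmx.
Qed.

(** No constraint on [G] is needed: on the whole span of the components of
    [Phi] the loss is finite and equal to the quadratic form of [H]. *)
Lemma L1loss_lincomb (G : 'cV[R]_K) :
  L1loss P X u (lincomb Phi G) = (quadform (Hmx P X u Phi) G)%:E.
Proof.
have ig := integrable_gram_term; have ir := integrable_rank1_term.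
rewrite /Hmx -expectation_mxB// -expectation_quadform; last first.
  exact: integrable_mxB.
congr ('E_P[_])%E; apply/funext => w.
by rewrite grad_lincomb// quadform_orthproj.
Qed.

End Loss.

(** * Transport of minimizers *)

(** Minimizing [f] over an image [h @` A] amounts to minimizing the
    pulled-back objective over [A]; [h] need not be injective. *)
Lemma minimizers_image {disp disp' : Order.disp_t} {U : porderType disp}
    {V : porderType disp'} {S S' : Type} (f : S -> U) (q : S' -> V)
    (h : S' -> S) (A : set S') :
  (forall a b, (f (h a) <= f (h b))%O = (q a <= q b)%O) ->
  minimizers f (h @` A) = h @` minimizers q A.
Proof.
move=> fq; apply/seteqP; split => g.
  move=> [[a Aa <-] amin]; exists a => //; split => // b Ab.
  by rewrite -fq; apply: amin; exists b.
move=> [a [Aa amin] <-]; split; first by exists a.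
by move=> _ [b Ab <-]; rewrite fq; exact: amin.
Qed.

Theorem proposition4p12 (disp : measure_display) (T : measurableType disp)
    (R : realType) (P : probability T R) (d K : nat)
    (X : {RV P >-> borelV R d})
    (u : 'cV[R]_d -> R) (Phi : 'cV[R]_d -> 'cV[R]_K) (Rm : 'M[R]_K)
    (hu : C1 u) (hPhi : C1 Phi) (hRm : posdef Rm)
    (hint : ('E_P[(fun w => fnorm (grad u (X w)) ^+ 2
                            * fnorm (gradm Phi (X w)) ^+ 2)%R] < +oo)%E) :
  minimizers (L1loss P X u) (G1class Rm Phi) =
  [set g | exists2 G, minimizers (quadform (Hmx P X u Phi)) (unit_sphere Rm) G
                    & g = lincomb Phi G].
Proof.
(* Both sides are images of sets of coefficient vectors under [lincomb Phi]. *)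
have imE (B : set 'cV[R]_K) :
    [set g | exists2 G, B G & g = lincomb Phi G] = lincomb Phi @` B.
  by apply/seteqP; split => g [G BG gE]; exists G.
rewrite /G1class !imE; apply: minimizers_image => G G'.
by rewrite !L1loss_lincomb// lee_fin.
Qed.
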